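(* Let $H$ be a complex Hilbert space and let $A$ and $B$ be two unbounded normal and invertible operators in $H$, such that all products formed from $A$, $B$ and their adjoints are densely defined. If $AB=BA$, then $$AB^*=B^*A\quad\text{and}\quad BA^*=A^*B.$$
   Context: ''Unbounded operator'' means a linear operator defined on a linear subspace $D(A)$ of $H$, not necessarily bounded. The product of operators is $(BA)x=B(Ax)$ with domain $D(BA)=\{x\in D(A): Ax\in D(B)\}$. $A\subset B$ means $D(A)\subset D(B)$ and $A$, $B$ coincide on $D(A)$. Equality of operators includes equality of domains; in particular $AB=BA$ means $D(AB)=D(BA)$ and $ABx=BAx$ for all $x$ in this common domain. Standing assumption: all operators, together with any operation (sum, product) involving them or their adjoints, are densely defined; bounded operators are defined on all of $H$. An operator $A$ is invertible if there is an everywhere defined bounded operator, denoted $A^{-1}$, on $H$ with $A^{-1}A\subset AA^{-1}=I$. A densely defined operator $A$ is normal if it is closed and $AA^*=A^*A$ (including equality of domains). *)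

(* Defs.v *)
(* MathComp / MathComp-Analysis development. *)
From HB Require Import structures.
From mathcomp Require Import all_boot all_order all_algebra.
From mathcomp Require Import sesquilinear.
From mathcomp Require Import complex.
From mathcomp Require Import all_classical all_reals all_analysis.

Set Implicit Arguments.
Unset Strict Implicit.
Unset Printing Implicit Defensive.

Import Order.TTheory GRing.Theory Num.Theory.
Import numFieldNormedType.Exports.

Local Open Scope classical_set_scope.
Local Open Scope ring_scope.
Local Open Scope complex_scope.

(* [inner] is linear in its first argument and conjugate-linear in the second.
   The norm takes its values in R[i] (in the nonnegative reals). *)
HB.mixin Record CompleteNormedModule_isHilbert (R : realType) H
    of CompleteNormedModule R[i] H := {
  inner : {dot H for (@Num.conj R[i])} ;
  inner_norm : forall x : H, `|x| ^+ 2 = inner x x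
}.

#[short(type="hilbertType")]
HB.structure Definition Hilbert (R : realType) :=
  {H of CompleteNormedModule R[i] H & CompleteNormedModule_isHilbert R H}.

(* A partially defined map H -> H. The values of [opfun A] outside [opdom A]
   carry no information: they play no role in [opsub] and [opeq]. *)
Record partial_op (H : Type) := PartialOp {
  opdom : set H ;
  opfun :> H -> H
}.

Section Operators.
Variables (R : realType) (H : hilbertType R).
Implicit Types A B : partial_op H.

Definition linear_op A : Prop :=
  [/\ opdom A 0,
      forall (a : R[i]) x y,
        opdom A x -> opdom A y -> opdom A (a *: x + y)
    & forall (a : R[i]) x y,
        opdom A x -> opdom A y -> A (a *: x + y) = a *: A x + A y].

Definition densely_defined A : Prop := dense (opdom A).

Definition opsub A B : Prop :=
  opdom A `<=` opdom B /\ (forall x, opdom A x -> A x = B x).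

Definition opeq A B : Prop :=
  opdom A = opdom B /\ (forall x, opdom A x -> A x = B x).

Definition opmul B A : partial_op H :=
  PartialOp [set x | opdom A x /\ opdom B (A x)] (fun x => B (A x)).

Definition everywhere (T : H -> H) : partial_op H := PartialOp setT T.

(* For densely defined A there is at most one z in [adjoint_graph A y], so that
   [xget] returns the value of the adjoint at y; when A is not densely defined
   it returns an arbitrary choice. *)
Definition adjoint_graph A (y : H) : set H :=
  [set z | forall x, opdom A x -> inner (A x) y = inner x z].

Definition adjoint A : partial_op H :=
  PartialOp [set y | adjoint_graph A y !=set0]
            (fun y => xget 0 (adjoint_graph A y)).

Definition closed_op A : Prop :=
  closed [set p : H * H | opdom A p.1 /\ A p.1 = p.2].

Definition normal_op A : Prop :=
  [/\ densely_defined A, closed_op A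
    & opeq (opmul A (adjoint A)) (opmul (adjoint A) A)].

Definition bounded_op (T : H -> H) : Prop :=
  exists M : R, forall x, `|T x| <= M%:C * `|x|.

Definition invertible_op A : Prop :=
  exists T : {linear H -> H},
    [/\ bounded_op T,
        opsub (opmul (everywhere T) A) (opmul A (everywhere T))
      & opeq (opmul A (everywhere T)) (everywhere id)].

Inductive product_of (S : set (partial_op H)) : partial_op H -> Prop :=
| product_of_factor A : S A -> product_of S A
| product_of_mul A B :
    product_of S A -> product_of S B -> product_of S (opmul A B).

End Operators.

(* Main.v *)
(* The inverses S and T of A and B are bounded operators.  Products of
   invertible operators commute, domains included, exactly when the inverses
   do; hence S T = T S, and S is normal because A is.  As the adjoint of A is
   inverted by S^*, it remains to prove Fuglede's theorem: if N is bounded and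
   normal, an X commuting with N commutes with N^*.

   Put D Y = N^* Y - Y N^*.  When Y commutes with N and
   W = z N^* - conj(z) N, one has
     Y + z D Y = (1 + W) Y (1 - W) + W Y W,
   and W is skew-adjoint, so the norm of Y + z D Y is at most
   1 + O(|z|^2) times that of Y.  The scalar products
   <(1 + z D)^m X x, y> are polynomials in z with linear coefficient
   m <D X x, y>.  A Cauchy estimate on the circle |z| = 1/k with m = k^2 gives
   k |D X| = O(|X|) for all k, hence D X = 0.  This is Rosenblum's argument
   with (1 + z D)^m in place of the exponential, so that no power series
   occurs. *)
From HB Require Import structures.
Require Import Defs.
From mathcomp Require Import all_boot all_order all_algebra.
From mathcomp Require Import all_classical all_reals all_analysis.
From mathcomp Require Import complex sesquilinear ring.
Set Implicit Arguments.
Unset Strict Implicit.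
Unset Printing Implicit Defensive.
Import Order.TTheory GRing.Theory Num.Theory.
Import numFieldNormedType.Exports.
Local Open Scope classical_set_scope.
Local Open Scope ring_scope.
Local Open Scope complex_scope.

(** * Cauchy estimates on a circle for the two lowest coefficients of a polynomial *)

Section CircleEstimates.
Variable C : numClosedFieldType.
Implicit Types (p : {poly C}) (r B : C).

Lemma horner_even_odd p z :
  p.[z] = (even_poly p).[z ^+ 2] + (odd_poly p).[z ^+ 2] * z.
Proof.
by rewrite -[in LHS](poly_even_odd p) !hornerE !horner_comp !hornerE.
Qed.

(** Averaging [p] over [z] and [- z] gives its even part at [z ^+ 2], with the same constant term
    and about half the size; induction on the size thus replaces Cauchy's integral. *)
Lemma coef0_le_circle p r B : 0 <= r ->
  (forall z, `|z| = r -> `|p.[z]| <= B) -> `|p`_0| <= B.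
Proof.
have [n] := ubnP (size p); elim: n p r => // n IHn p r szp r0 pB.
have [sz1|sz1] := leqP (size p) 1.
  have := pB r (ger0_norm r0).
  by rewrite {1}(size1_polyC sz1) hornerC.
rewrite -[0%N]/(0.*2) -coef_even_poly; apply: (IHn _ (r ^+ 2)).
- apply: (leq_ltn_trans (size_even_poly p)).
  rewrite ltnS in szp; apply: (leq_trans _ szp).
  by rewrite ltn_uphalf_double -addnn -addn1 ltn_add2l.
- exact: exprn_ge0.
move=> w wr; pose z := sqrtC w.
have zr : `|z| = r.
  by apply/eqP; rewrite -(eqrXn2 (n := 2)) // -normrX sqrtCK wr.
have -> : (even_poly p).[w] = (p.[z] + p.[- z]) / 2.
  rewrite (horner_even_odd p z) (horner_even_odd p (- z)) sqrrN sqrtCK.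
  by field.
rewrite normrM normfV (normr_nat _ 2) ler_pdivrMr ?ltr0n //.
rewrite (le_trans (ler_normD _ _)) // mulr_natr mulr2n lerD // pB //.
by rewrite normrN.
Qed.

(** Half the difference of the values at [z] and [- z], divided by [z], is the odd part at [z ^+ 2],
    whose constant term is the linear coefficient of [p]. *)
Lemma coef1_le_circle p r B : 0 < r ->
  (forall z, `|z| = r -> `|p.[z]| <= B) -> `|p`_1| * r <= B.
Proof.
move=> r0 pB; have r_ge0 := ltW r0.
rewrite -ler_pdivlMr // -[1%N]/(0.*2.+1) -coef_odd_poly.
apply: (@coef0_le_circle _ (r ^+ 2)); first exact: exprn_ge0.
move=> w wr; pose z := sqrtC w.
have zr : `|z| = r.
  by apply/eqP; rewrite -(eqrXn2 (n := 2)) // -normrX sqrtCK wr.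
have z0 : z != 0 by rewrite -normr_gt0 zr.
have -> : (odd_poly p).[w] = (p.[z] - p.[- z]) / 2 / z.
  rewrite (horner_even_odd p z) (horner_even_odd p (- z)) sqrrN sqrtCK.
  by field.
rewrite !normrM !normfV (normr_nat _ 2) zr ler_pM2r ?invr_gt0 //.
rewrite ler_pdivrMr ?ltr0n // (le_trans (ler_normB _ _)) //.
by rewrite mulr_natr mulr2n lerD // pB // normrN.
Qed.

End CircleEstimates.

(** * Inner product calculus and the Cauchy-Schwarz inequality *)

Section Inner.
Variables (R : realType) (H : hilbertType R).
Implicit Types x y z : H.

Lemma innerC x y : inner y x = (inner x y)^*%R.
Proof. by rewrite hermC /= mul1r. Qed.

Lemma innerDl x y z : inner (x + y) z = inner x z + inner y z.
Proof. exact: linearDl. Qed.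
Lemma innerDr x y z : inner z (x + y) = inner z x + inner z y.
Proof. exact: linearDr. Qed.
Lemma innerBl x y z : inner (x - y) z = inner x z - inner y z.
Proof. exact: linearBl. Qed.
Lemma innerBr x y z : inner z (x - y) = inner z x - inner z y.
Proof. exact: linearBr. Qed.
Lemma innerZl a x z : inner (a *: x) z = a * inner x z.
Proof. exact: linearZl_LR. Qed.
Lemma innerZr a x z : inner z (a *: x) = a^*%R * inner z x.
Proof. exact: linearZr_LR. Qed.

Lemma sqr_normD x y :
  `|x + y| ^+ 2 = `|x| ^+ 2 + `|y| ^+ 2 + (inner x y + (inner x y)^*%R).
Proof. by rewrite !inner_norm dnormD. Qed.

Lemma inner_ext x y : (forall z, inner z x = inner z y) -> x = y.
Proof.
move=> xy; apply/eqP; rewrite -subr_eq0 -normr_eq0 -sqrf_eq0.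
by rewrite inner_norm innerBr xy subrr.
Qed.

Lemma cauchy_schwarz x y : `|inner x y| <= `|x| * `|y|.
Proof.
have [->|y0] := eqVneq y 0; first by rewrite normr0 mulr0 linear0r normr0.
have ny : 0 < `|y| by rewrite normr_gt0.
rewrite -(ler_pXn2r (n := 2)) ?nnegrE ?mulr_ge0 //.
set d := inner x y.
(* This is the component of [x] orthogonal to [y]; its squared norm is |x|^2 - |d|^2 / |y|^2. *)
have : 0 <= `|x + (- (d / `|y| ^+ 2)) *: y| ^+ 2 by rewrite exprn_ge0.
rewrite sqr_normD innerZr -/d normrZ normrN rmorphN rmorphM /= fmorphV rmorphXn.
rewrite /= (CrealP (normr_real _)) normrM normfV.
rewrite rmorphM rmorphN rmorphM /= conjCK fmorphV rmorphXn.
rewrite /= (CrealP (normr_real y)) normrX normr_id exprMn !mulNr (mulrAC d^*%R).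
rewrite exprMn normCK => h.
have : 0 <= `|x| ^+ 2 - d * d^*%R / `|y| ^+ 2.
  by congr (0 <= _): h; field; rewrite normr_eq0.
by rewrite subr_ge0 ler_pdivrMr ?exprn_gt0 // exprMn.
Qed.
End Inner.

(** Nonnegativity in [R[i]] makes [a] real, so comparing real parts reduces this to the Archimedean
    property of [R]. *)
Lemma complex_archi0 (R : realType) (a b : R[i]) : 0 <= a ->
  (forall k : nat, a * k.+1%:R <= b) -> a = 0.
Proof.
case: a => a a'; rewrite lecE /= => /andP[/eqP-> a0] ab; apply/eqP.
rewrite eq_complex /= eqxx andbT eq_le a0 andbT leNgt; apply/negP => apos.
have abR k : a * k.+1%:R <= complex.Re b.
  have := ab k.
  rewrite complexr0 -[k.+1%:R](rmorph_nat (real_complex R)) -rmorphM /=.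
  by rewrite lecE => /andP[].
have := abR (Num.truncn (complex.Re b / a)).
rewrite mulrC -ler_pdivlMr // leNgt.
by rewrite truncnS_gt.
Qed.

(** * Riesz representation of bounded linear functionals *)

Section Riesz.
Variables (R : realType) (H : hilbertType R).
Variables (f : H -> R[i]) (M : R).
Hypothesis f_lin : linear_for *%R f.
Hypothesis f_bound : forall x, `|f x| <= M%:C * `|x|.

(** If [y] represents [f], this is |x - y|^2 - |y|^2, minimal exactly at [y]. The real part only
    moves a real value into [R], where infima are taken. *)
Let J x : R := complex.Re (`|x| ^+ 2 - (f x + (f x)^*%R)).

Let JE x : (J x)%:C = `|x| ^+ 2 - (f x + (f x)^*%R).
Proof.
apply: RRe_real; rewrite rpredB ?rpredX ?normr_real //.
by rewrite CrealE rmorphD /= conjCK addrC.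
Qed.

(** Completing the square: |x|^2 - 2 M |x| >= - M^2. *)
Let J_ge x : - M ^+ 2 <= J x.
Proof.
rewrite -lecR JE rmorphN rmorphXn /=.
have lin : f x + (f x)^*%R <= 2 * M%:C * `|x|.
  have real_s : f x + (f x)^*%R \is Num.real.
    by rewrite CrealE rmorphD /= conjCK addrC.
  rewrite (le_trans (real_ler_norm real_s)) // (le_trans (ler_normD _ _)) //.
  by rewrite norm_conjC -mulr2n -mulrA mulr_natl lerMn2r f_bound.
have sq : 0 <= (`|x| - M%:C) ^+ 2.
  rewrite real_exprn_even_ge0 // rpredB ?normr_real //.
  by apply/complex_realP; exists M.
rewrite -subr_ge0; apply: le_trans sq _; rewrite -subr_ge0.
have -> : `|x| ^+ 2 - (f x + (f x)^*%R) - - M%:C ^+ 2 - (`|x| - M%:C) ^+ 2 =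
  2 * M%:C * `|x| - (f x + (f x)^*%R) by ring.
by rewrite subr_ge0.
Qed.

(* First variation of J(x) = |x|^2 - 2 Re f(x) at a near-minimiser. *)
Let approx_riesz (e : R) : 0 < e ->
  exists x, forall h, `|inner h x - f h| <= e%:C * `|h|.
Proof.
move=> e0.
have hinf : has_inf (range J).
  split; first by exists (J 0), 0.
  by exists (- M ^+ 2) => _ [x _ <-].
have [_ [x _ <-] Jx] := inf_adherent (exprn_gt0 2 e0) hinf.
exists x => h; have [->|h0] := eqVneq h 0.
  by have := f_bound 0; rewrite normr0 !mulr0 linear0l sub0r normrN.
have nh : 0 < `|h| by rewrite normr_gt0.
have ec : 0 <= e%:C by rewrite ler0c ltW.
rewrite -(ler_pXn2r (n := 2)) ?nnegrE ?mulr_ge0 //.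
set g := inner h x - f h.
(* This [t] minimises [J (x + t *: h)], lowering [J x] by |g|^2 / |h|^2; the drop is at most
   [e ^+ 2] by the choice of [x]. *)
pose t := - (g / `|h| ^+ 2)^*%R.
have : J x - e ^+ 2 <= J (x + t *: h).
  apply: (@le_trans _ _ (inf (range J))); first by rewrite lerBlDr ltW.
  by apply: ge_inf; [case: hinf|exists (x + t *: h)].
have ft : f (x + t *: h) = f x + t * f h by rewrite addrC f_lin addrC.
have hx : inner x (t *: h) = (t * inner h x)^*%R.
  by rewrite innerZr rmorphM /= -innerC.
have tg : t * g = - (`|g| ^+ 2 / `|h| ^+ 2).
  rewrite /t rmorphM /= fmorphV rmorphXn /= (CrealP (normr_real _)) normCK.
  by ring.
have tt : `|t| ^+ 2 = `|g| ^+ 2 / `|h| ^+ 2 ^+ 2.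
  rewrite normrN norm_conjC normrM normfV normrX normr_id.
  by rewrite exprMn exprVn.
rewrite -lecR rmorphB /= !JE rmorphXn /= sqr_normD ft hx.
rewrite conjCK normrZ exprMn tt.
rewrite rmorphD /= => var.
suff : 0 <= e%:C ^+ 2 - `|g| ^+ 2 / `|h| ^+ 2.
  by rewrite subr_ge0 ler_pdivrMr ?exprn_gt0 // exprMn.
have tgC : (t * g)^*%R = t * g.
  rewrite tg rmorphN rmorphM /= fmorphV !rmorphXn /=.
  by rewrite !(CrealP (normr_real _)).
have -> : e%:C ^+ 2 - `|g| ^+ 2 / `|h| ^+ 2 =
    e%:C ^+ 2 + `|g| ^+ 2 / `|h| ^+ 2 + (t * g + (t * g)^*%R).
  by rewrite tgC tg; ring.
rewrite -subr_ge0 in var; congr (0 <= _): var.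
by rewrite /g mulrBr rmorphB /=; field; rewrite normr_eq0.
Qed.

(** Approximate representing vectors with errors 1/(n+1) form a Cauchy sequence, as testing two of
    them on their difference shows; completeness gives the limit. *)
Lemma riesz : exists y, forall x, f x = inner x y.
Proof.
have /choice [u uP] : forall n : nat, exists x,
    forall h, `|inner h x - f h| <= (n.+1%:R^-1 : R)%:C * `|h|.
  by move=> n; apply: approx_riesz; rewrite invr_gt0 ltr0n.
have uB n m : `|u n - u m| <= (n.+1%:R^-1 + m.+1%:R^-1 : R)%:C.
  set h := u n - u m; have [->|h0] := eqVneq h 0.
    by rewrite normr0 ler0c addr_ge0 // invr_ge0 ler0n.
  have nh : 0 < `|h| by rewrite normr_gt0.
  have hh : `|h| * `|h| = (inner h (u n) - f h) - (inner h (u m) - f h).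
    by rewrite -expr2 inner_norm {2}/h innerBr; ring.
  rewrite -(ler_pM2r nh) -[leLHS]ger0_norm ?mulr_ge0 // hh.
  by rewrite (le_trans (ler_normB _ _)) // rmorphD mulrDl lerD.
have cvg_u : cvg (u @ \oo).
  apply: cauchy_cvg; apply: cauchy_exP => e e0.
  have eE : (complex.Re e)%:C = e by rewrite RRe_real // gtr0_real.
  have e2 : 0 < complex.Re e / 2 by rewrite divr_gt0 // -ltcR eE.
  have [N _ NP] := near_infty_natSinv_lt (PosNum e2).
  exists (u N); exists N => // n Nn /=.
  rewrite -ball_normE /= (le_lt_trans (uB _ _)) // -eE ltcR.
  by rewrite [ltRHS]splitr ltrD //; apply: NP => /=.
exists (lim (u @ \oo)) => x; set l := lim _.
apply/eqP; rewrite eq_sym -subr_eq0 -normr_eq0; apply/eqP.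
apply: (@complex_archi0 _ _ (`|x| + `|x|)) => // k.
have /cvgrPdist_lt /(_ (k.+1%:R^-1)) := cvg_u.
rewrite invr_gt0 ltr0n => /(_ isT) [N _ NP].
(* Beyond both [N] and [k], the distance to the limit and the error of [u n] each contribute at most
   |x|/(k+1). *)
pose n := maxn N k.
have un : `|inner x l - f x| <= `|x| * k.+1%:R^-1 + (n.+1%:R^-1 : R)%:C * `|x|.
  have -> : inner x l - f x = inner x (l - u n) + (inner x (u n) - f x).
    by rewrite innerBr; ring.
  rewrite (le_trans (ler_normD _ _)) // lerD //.
  rewrite (le_trans (cauchy_schwarz _ _)) //.
  by rewrite ler_wpM2l // ltW // NP //= leq_maxl.
rewrite -ler_pdivlMr ?ltr0n // (le_trans un) // mulrDl lerD //.
rewrite mulrC ler_wpM2l //.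
rewrite -[k.+1%:R](rmorph_nat (real_complex R)) -fmorphV lecR.
by rewrite lef_pV2 ?posrE ?ltr0n // ler_nat ltnS leq_maxr.
Qed.
End Riesz.

(** * Adjoints of bounded operators *)

Section BoundedAdjoint.
Variables (R : realType) (H : hilbertType R).
Implicit Types T : {linear H -> H}.

Lemma bounded_op_ge0 (T : H -> H) : bounded_op T ->
  exists2 M : R, 0 <= M & forall x, `|T x| <= M%:C * `|x|.
Proof.
move=> [M MP]; exists `|M| => // x; apply: (le_trans (MP x)).
by rewrite ler_wpM2r // lecR ler_norm.
Qed.

(** Cauchy-Schwarz applied to |T' y|^2 = <T (T' y), y>. *)
Lemma adjoint_bound (T T' : H -> H) (M : R) :
  (forall x y, inner (T x) y = inner x (T' y)) ->
  (forall x, `|T x| <= M%:C * `|x|) -> forall y, `|T' y| <= M%:C * `|y|.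
Proof.
move=> adj TM y; have [->|ny] := eqVneq (T' y) 0.
  by rewrite normr0; apply: le_trans (TM y).
rewrite -(@ler_pM2r _ `|T' y|) ?normr_gt0 // -expr2 inner_norm -adj.
have := cauchy_schwarz (T (T' y)) y; rewrite adj -inner_norm normrX normr_id.
by move=> /le_trans; apply; rewrite mulrAC ler_wpM2r.
Qed.

(** Riesz represents x -> <T x, y> for each [y]; uniqueness of the representing vector makes the
    choice linear. *)
Lemma bounded_adjoint T : bounded_op T -> exists2 T' : {linear H -> H},
  bounded_op T' & forall x y, inner (T x) y = inner x (T' y).
Proof.
move=> [M TM].
have /choice[T' adj] : forall y, exists z, forall x, inner (T x) y = inner x z.
  move=> y; apply: (@riesz _ _ _ (M * complex.Re `|y|)) => [a u v|x].
    by rewrite linearP linearPl.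
  rewrite (le_trans (cauchy_schwarz _ _)) // rmorphM /= RRe_real ?normr_real //.
  by rewrite mulrAC ler_wpM2r.
have lin : linear T'.
  move=> a u v; apply: inner_ext => x.
  by rewrite -adj innerDr innerZr !adj innerDr innerZr.
pose T'l : {linear H -> H} := HB.pack T' (GRing.isLinear.Build _ _ _ _ T' lin).
exists T'l; last by move=> x y; rewrite adj.
by exists M; apply: adjoint_bound TM => x y; rewrite adj.
Qed.

End BoundedAdjoint.

(** * Fuglede's theorem for a bounded normal operator *)

Section Fuglede.
Variables (R : realType) (H : hilbertType R) (N N' : {linear H -> H}) (M : R).
Hypothesis adjN : forall x y, inner (N x) y = inner x (N' y).
Hypothesis NM : forall x, `|N x| <= M%:C * `|x|.
Hypothesis M0 : 0 <= M.
Hypothesis normalN : forall x, N (N' x) = N' (N x).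

Let adjN' x y : inner (N' x) y = inner x (N y).
Proof. by rewrite innerC -adjN -innerC. Qed.

Let N'M x : `|N' x| <= M%:C * `|x|.
Proof. exact: adjoint_bound NM x. Qed.

Let M0c : 0 <= M%:C. Proof. by rewrite ler0c. Qed.

Definition skew_comb z x := z *: N' x - z^*%R *: N x.
Local Notation W := skew_comb.

Let skewW z x y : inner (W z x) y = - inner x (W z y).
Proof.
by rewrite innerBl innerBr !innerZl !innerZr adjN adjN' conjCK opprB.
Qed.

Let W_bound z x : `|W z x| <= 2 * `|z| * M%:C * `|x|.
Proof.
rewrite (le_trans (ler_normB _ _)) // !normrZ norm_conjC.
by rewrite -!mulrA mulr_natl mulr2n lerD // ler_wpM2l ?N'M ?NM.
Qed.

(** Skew-adjointness cancels the cross terms, so the first-order term in [z] disappears. *)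
Let addW_bound z x (s : bool) :
  `|x + (-1) ^+ s *: W z x| ^+ 2 <= (1 + 4 * `|z| ^+ 2 * M%:C ^+ 2) * `|x| ^+ 2.
Proof.
have d0 : inner x (W z x) + (inner x (W z x))^*%R = 0.
  by rewrite -innerC skewW subrr.
rewrite sqr_normD innerZr rmorphM /= conjCK.
have -> : ((-1) ^+ s)^*%R = (-1) ^+ s :> R[i] by rewrite rmorph_sign.
rewrite -mulrDr d0 mulr0 addr0 normrZ normrX normrN1 expr1n mul1r.
rewrite mulrDl mul1r lerD2l.
have -> : 4 * `|z| ^+ 2 * M%:C ^+ 2 * `|x| ^+ 2 =
    (2 * `|z| * M%:C * `|x|) ^+ 2 by ring.
by rewrite lerXn2r ?nnegrE ?mulr_ge0.
Qed.

(** The operator 1 + z D, an Euler step for Y' = D Y. It acts on bare maps so that it can be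
    iterated. *)
Definition euler_step z (Y : H -> H) x := Y x + z *: (N' (Y x) - Y (N' x)).
Local Notation E := euler_step.

Let E_linear z (Y : {linear H -> H}) :
  exists Y' : {linear H -> H}, E z Y = Y'.
Proof. by exists (Y \+ z \*: ((N' \o Y) \- (Y \o N'))). Qed.

Let E_comm z (Y : {linear H -> H}) : (forall x, Y (N x) = N (Y x)) ->
  forall x, E z Y (N x) = N (E z Y x).
Proof.
move=> YN x; rewrite /E [RHS]linearD [N (_ *: _)]linearZ.
by rewrite [N (_ - _)]linearB /= normalN -normalN !YN.
Qed.

(** With c = 4 |z|^2 M^2, the factors 1 + W and 1 - W contribute sqrt(1 + c) each and W Y W
    contributes c, whence 1 + 2c. *)
Let E_bound z (Y : {linear H -> H}) (b : R[i]) :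
  (forall x, Y (N x) = N (Y x)) -> 0 <= b -> (forall x, `|Y x| <= b * `|x|) ->
  forall x, `|E z Y x| <= (1 + 8 * `|z| ^+ 2 * M%:C ^+ 2) * b * `|x|.
Proof.
move=> YN b0 Yb x; pose v := x - W z x.
have -> : E z Y x = (Y v + W z (Y v)) + W z (Y (W z x)).
  have YW : Y (W z x) = z *: Y (N' x) - z^*%R *: N (Y x).
    by rewrite linearB !linearZ /= YN.
  have WB u w : W z (u - w) = W z u - W z w.
    rewrite /W (linearB N') (linearB N) !scalerBr !opprD !opprK.
    by rewrite !addrA [in LHS](addrAC (z *: _)).
  have -> : Y v = Y x - Y (W z x) by exact: linearB.
  rewrite WB -[RHS]addrA subrK YW /E [W z (Y x)]/W scalerBr -addrA opprB.
  by congr (_ + _); rewrite [RHS]addrC addrA subrK.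
set c := 4 * `|z| ^+ 2 * M%:C ^+ 2.
have c0 : 0 <= c by rewrite !mulr_ge0 ?exprn_ge0.
have -> : (1 + 8 * `|z| ^+ 2 * M%:C ^+ 2) * b * `|x| =
   (1 + c) * b * `|x| + c * b * `|x| by rewrite /c; ring.
rewrite (le_trans (ler_normD _ _)) // lerD //.
  rewrite -(ler_pXn2r (n := 2)) ?nnegrE ?mulr_ge0 ?addr_ge0 //.
  have := addW_bound z (Y v) false; rewrite scale1r => /le_trans; apply.
  have -> : ((1 + c) * b * `|x|) ^+ 2 =
      (1 + c) * (b ^+ 2 * ((1 + c) * `|x| ^+ 2)) by ring.
  rewrite ler_wpM2l ?addr_ge0 //.
  apply: (@le_trans _ _ ((b * `|v|) ^+ 2)).
    by rewrite lerXn2r ?nnegrE ?mulr_ge0.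
  rewrite exprMn ler_wpM2l ?exprn_ge0 //.
  by have := addW_bound z x true; rewrite expr1 scaleN1r.
rewrite (le_trans (W_bound _ _)) //.
have -> : c * b * `|x| = 2 * `|z| * M%:C * (b * (2 * `|z| * M%:C * `|x|)).
  by rewrite /c; ring.
rewrite ler_wpM2l ?mulr_ge0 // (le_trans (Yb _)) //.
by rewrite ler_wpM2l.
Qed.

Let iterE_bound m z (Y : {linear H -> H}) (b : R[i]) :
  (forall x, Y (N x) = N (Y x)) -> 0 <= b -> (forall x, `|Y x| <= b * `|x|) ->
  forall x, `|iter m (E z) Y x| <=
    (1 + 8 * `|z| ^+ 2 * M%:C ^+ 2) ^+ m * b * `|x|.
Proof.
elim: m Y b => [|m IHm] Y b YN b0 Yb x; first by rewrite expr0 mul1r Yb.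
rewrite iterSr; have [Y' Y'E] := E_linear z Y.
rewrite Y'E exprSr -(mulrA _ _ b); apply: IHm => [u| |u].
- by rewrite -Y'E E_comm.
- by rewrite mulr_ge0 ?addr_ge0 ?mulr_ge0 ?exprn_ge0.
- by rewrite -Y'E; apply: E_bound.
Qed.

Let iterE_lin m z a (Y Y' : H -> H) x :
  iter m (E z) (fun x => Y x + a *: Y' x) x =
  iter m (E z) Y x + a *: iter m (E z) Y' x.
Proof.
elim: m x => //= m IHm x.
have EE Z u : E z Z u = Z u + z *: (N' (Z u) - Z (N' u)) by [].
rewrite !EE !IHm [N' (_ + _)]linearD [N' (_ *: _)]linearZ /= opprD addrACA.
rewrite [z *: (_ - _ + _)]scalerDr [LHS]addrACA -scalerBr.
by rewrite [a *: (_ + z *: _)]scalerDr !scalerA (mulrC z).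
Qed.

(** Induction through (1 + z D)^(m+1) Y = (1 + z D)^m Y + z (1 + z D)^m (D Y), which needs the
    hypothesis for both [Y] and D Y. *)
Let iterE_poly m (Y : H -> H) x y : exists p : {poly R[i]},
  [/\ forall z, inner (iter m (E z) Y x) y = p.[z],
      p`_0 = inner (Y x) y
    & p`_1 = m%:R * inner (N' (Y x) - Y (N' x)) y].
Proof.
elim: m Y => [|m IHm] Y.
  exists (inner (Y x) y)%:P.
  by split=> [z||]; rewrite ?hornerC ?coefC //= mul0r.
have [p [pE p0 p1]] := IHm Y.
have [q [qE q0 q1]] := IHm (fun x => N' (Y x) - Y (N' x)).
exists (p + q * 'X); split=> [z||].
- rewrite iterSr hornerD hornerMX -pE -qE [E z Y](_ : _ =
    (fun x => Y x + z *: (N' (Y x) - Y (N' x)))) //.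
  by rewrite iterE_lin innerDl innerZl mulrC.
- by rewrite coefD coefMX /= addr0.
- by rewrite coefD coefMX /= p1 q0 -[m.+1]addn1 natrD mulrDl mul1r.
Qed.

Lemma fuglede (X : {linear H -> H}) : bounded_op X ->
  (forall x, X (N x) = N (X x)) -> forall x, X (N' x) = N' (X x).
Proof.
move=> /bounded_op_ge0[b b0 Xb] XN x.
set D := N' (X x) - X (N' x).
suff : `|D| = 0 by move=> /eqP; rewrite normr_eq0 subr_eq0 => /eqP.
(* Here exp(8 M^2) bounds (1 + 8 M^2 / m)^m for all [m]. *)
pose K := (expR (8 * M ^+ 2) * b)%:C * `|x|.
apply: (@complex_archi0 _ _ K) => // k.
have [->|D0] := eqVneq D 0.
  by rewrite normr0 mul0r mulr_ge0 // ler0c mulr_ge0 // expR_ge0.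
have nD : 0 < `|D| by rewrite normr_gt0.
rewrite -(ler_pM2r nD).
(* On the circle of radius 1/(k+1) one has m |z|^2 = 1. Pairing with [D] itself makes the linear
   coefficient m |D|^2. *)
pose m := (k.+1 ^ 2)%N; have [p [pE p0 p1]] := iterE_poly m X x D.
have k0 : 0 < k.+1%:R :> R[i] by rewrite ltr0n.
have := @coef1_le_circle _ p k.+1%:R^-1 (K * `|D|); rewrite invr_gt0 => /(_ k0).
rewrite p1 normrM normr_nat -inner_norm normrX normr_id /m natrX.
have -> : k.+1%:R ^+ 2 * `|D| ^+ 2 / k.+1%:R = `|D| * k.+1%:R * `|D| :> R[i].
  by field; rewrite nat1r pnatr_eq0.
apply => z zk; rewrite -pE (le_trans (cauchy_schwarz _ _)) // ler_wpM2r //.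
rewrite (le_trans (iterE_bound _ _ XN _ Xb _)) ?ler0c // ler_wpM2r //.
rewrite rmorphM ler_wpM2r ?ler0c // zk.
have -> : 1 + 8 * k.+1%:R^-1 ^+ 2 * M%:C ^+ 2 = (1 + 8 * M ^+ 2 / m%:R)%:C.
  rewrite rmorphD !rmorphM /= fmorphV !rmorph_nat /m natrX.
  by field; rewrite nat1r pnatr_eq0.
rewrite -rmorphXn lecR.
have m0 : (0 < m)%N by rewrite expn_gt0.
apply: (@le_trans _ _ (expR (8 * M ^+ 2 / m%:R) ^+ m)).
  rewrite lerXn2r ?nnegrE ?expR_ge0 ?expR_ge1Dx //.
  by rewrite addr_ge0 ?divr_ge0 ?mulr_ge0 ?sqr_ge0.
by rewrite -expRM_natr divfK // pnatr_eq0 -lt0n.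
Qed.
End Fuglede.

(** * Passage between unbounded operators and their bounded inverses *)

Section UnboundedOperators.
Variables (R : realType) (H : hilbertType R).
Implicit Types (A B P Q : partial_op H) (S T : {linear H -> H}).

Definition inverse_of P (S : H -> H) : Prop :=
  [/\ forall u, opdom P (S u), forall u, P (S u) = u
    & forall x, opdom P x -> S (P x) = x].

Lemma invertible_inverse A : invertible_op A ->
  exists2 S : {linear H -> H}, bounded_op S & inverse_of A S.
Proof.
move=> [S [bS [SAd SA] [ASd AS]]]; exists S => //.
have AS1 u : A (S u) = u.
  by apply: AS; rewrite ASd.
split => [u|//|x Ax]; first by have : setT u by []; rewrite -[setT]ASd => -[].
by have := SA x (conj Ax I); rewrite /= AS1.
Qed.

Lemma opmul_comm_inverse P Q (S T : H -> H) :
  inverse_of P S -> inverse_of Q T ->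
  (forall u, S (T u) = T (S u)) -> opeq (opmul P Q) (opmul Q P).
Proof.
have half P1 Q1 (S1 T1 : H -> H) x : inverse_of P1 S1 -> inverse_of Q1 T1 ->
    (forall u, S1 (T1 u) = T1 (S1 u)) -> opdom (opmul P1 Q1) x ->
    opdom (opmul Q1 P1) x /\ P1 (Q1 x) = Q1 (P1 x).
  move=> [PS PSK SPK] [QT QTK TQK] ST [Qx PQx].
  set u := P1 (Q1 x) in PQx *.
  (* Writing [x] as a value of the commuting inverses places it in the domain of the other
     product. *)
  have xE : x = S1 (T1 u) by rewrite ST SPK // TQK.
  by rewrite /= xE PSK QTK.
move=> iP iQ ST; split=> [|x xPQ].
  2: by have [] := half P Q S T x iP iQ ST xPQ.
by apply/seteqP; split=> x /half; [move=> /(_ S T)|move=> /(_ T S)]; case.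
Qed.

(** Both P Q and Q P send T S u to [u]; applying S T to the latter equation gives the claim. *)
Lemma inverse_comm P Q (S T : H -> H) :
  inverse_of P S -> inverse_of Q T ->
  opeq (opmul P Q) (opmul Q P) -> forall u, S (T u) = T (S u).
Proof.
move=> [PS PSK SPK] [QT QTK TQK] [dPQ PQ] u.
have dx : opdom (opmul P Q) (T (S u)) by split; rewrite //= QTK.
have := PQ _ dx; rewrite dPQ in dx; case: dx => /= Px QPx.
by rewrite QTK PSK => uE; rewrite [in LHS]uE TQK // SPK.
Qed.

(** Otherwise some [x] in [D] is closer to [w] than |w|, yet |w|^2 = <w - x, w> <= |w - x| |w|. *)
Lemma dense_orthogonal (D : set H) w : dense D ->
  (forall x, D x -> inner x w = 0) -> w = 0.
Proof.
move=> dD wD; apply/eqP; apply: contraT => w0.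
have nw : 0 < `|w| by rewrite normr_gt0.
have [|x [wx /wD xw]] := dD (ball w `|w|) _ (ball_open _ _).
  by exists w; exact: ballxx.
move: wx; rewrite -ball_normE /= => wx.
have := cauchy_schwarz (w - x) w.
rewrite innerBl xw subr0 -inner_norm normrX normr_id expr2 ler_pM2r //.
by move=> /le_lt_trans /(_ wx); rewrite ltxx.
Qed.

Lemma adjoint_graph_adjoint A y z : densely_defined A -> adjoint_graph A y z ->
  opdom (adjoint A) y /\ adjoint A y = z.
Proof.
move=> dA yz; split; first by exists z.
rewrite /=; case: xgetP => [v _ yv|]; last by move=> /(_ z).
apply/eqP; rewrite -subr_eq0; apply/eqP; apply: (dense_orthogonal dA) => x Ax.
by rewrite innerBr -yz // -yv // subrr.
Qed.

Lemma adjoint_inverse A (S S' : H -> H) : densely_defined A -> inverse_of A S ->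
  (forall x y, inner (S x) y = inner x (S' y)) -> inverse_of (adjoint A) S'.
Proof.
move=> dA [AS ASK SAK] adj.
have S'A u : opdom (adjoint A) (S' u) /\ adjoint A (S' u) = u.
  by apply: adjoint_graph_adjoint => // x Ax; rewrite -adj SAK.
split=> [u|u|y [z yz]]; [by case: (S'A u)..|].
rewrite (adjoint_graph_adjoint dA yz).2; apply: inner_ext => u.
by rewrite -adj -(yz (S u)) // ASK.
Qed.

(** Normality of [A] passes to [S], and commutation of [A] and [B] to [S] and [T]. Fuglede's theorem
    makes [T] commute with the inverse [S'] of the adjoint of [A]. *)
Lemma fuglede_invertible A B :
  normal_op A -> invertible_op A -> invertible_op B ->
  opeq (opmul A B) (opmul B A) ->
  opeq (opmul B (adjoint A)) (opmul (adjoint A) B).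
Proof.
move=> [dA _ AA] /invertible_inverse[S bS AS] /invertible_inverse[T bT BT] AB.
have [S' _ adjS] := bounded_adjoint bS.
have A'S' := adjoint_inverse dA AS adjS.
have SS' := inverse_comm AS A'S' AA.
have TS := inverse_comm AS BT AB.
have [M M0 SM] := bounded_op_ge0 bS.
apply: (opmul_comm_inverse BT A'S').
by apply: (fuglede adjS SM M0 SS' bT) => x; rewrite TS.
Qed.

End UnboundedOperators.

Theorem theorem6 (R : realType) (H : hilbertType R) (A B : partial_op H)
    (linA : linear_op A) (linB : linear_op B)
    (normalA : normal_op A) (normalB : normal_op B)
    (invA : invertible_op A) (invB : invertible_op B)
    (denseP : forall P : partial_op H,
      product_of [set A; adjoint A; B; adjoint B] P -> densely_defined P)
    (commAB : opeq (opmul A B) (opmul B A)) :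
  opeq (opmul A (adjoint B)) (opmul (adjoint B) A) /\
  opeq (opmul B (adjoint A)) (opmul (adjoint A) B).
Proof.
split; last exact: fuglede_invertible.
(* The first equality exchanges the roles of [A] and [B]. *)
apply: fuglede_invertible => //.
by case: commAB => dAB AB; split=> [|x]; rewrite -dAB // => /AB.
Qed.
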